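(* The category $\mathsf{bRSA}$ of bRS-algebras is dually equivalent to the category $\mathsf{bRSS}$ of bRS-spaces.
   Context: A relative Stone algebra is $(A,\wedge,\vee,\to,t)$ with $(A,\wedge,\vee)$ a lattice with top $t$, $a\wedge b\le c\iff a\le b\to c$, and $(a\to b)\vee(b\to a)=t$. A bRS-algebra is a relative Stone algebra with a constant $f$ satisfying $a\vee(a\to f)=t$ for all $a$; $\mathsf{bRSA}$ has all homomorphisms as morphisms. A Priestley space $(X,\le,\tau)$ is a compact space with a partial order such that $x\not\le y$ implies some clopen up-set contains $x$ but not $y$; it is Esakia if $\downarrow U$ is clopen for all clopen $U$; pointed if it has a greatest element $\top$. A poset is a forest if ${\uparrow}x$ is a chain for every $x$. A bRS-space is $(X,\le,D,\top,\tau)$ where $(X,\le,\top,\tau)$ is a pointed Esakia space, $(X,\le)$ is a forest, and $D$ is a clopen set of $\le$-minimal elements. A $\mathsf{bRSS}$-morphism $\varphi\colon X\to Y$ is a continuous p-morphism ($\varphi$ isotone, and $\varphi(x)\le z$ implies $\exists y\ge x$ with $\varphi(y)=z$) with $\varphi(\top_X)=\top_Y$, $\varphi[D_X]\subseteq D_Y$ and $\varphi[X\setminus D_X]\subseteq Y\setminus D_Y$. (The duality sends a bRS-algebra to its space of prime filters together with $A$ itself, ordered by inclusion, with the Priestley topology and designated set $\{x: f\notin x\}$; a bRS-space goes to its nonempty clopen up-sets with $f:=X\setminus D$.)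
   Formalization: A bRS-space is additionally required to have its greatest element ⊤ outside D; this excludes only the one-point space with D = {⊤}, for which X∖D is empty and the stated duality fails. *)

(* Defs.v *)
From HB Require Import structures.
From mathcomp Require Import all_boot all_order.
From mathcomp Require Import boolp classical_sets topology.

Set Implicit Arguments.
Unset Strict Implicit.
Unset Printing Implicit Defensive.

Import Order.TTheory.
Local Open Scope classical_set_scope.

Record category := Category {
  Obj :> Type;
  Hom : Obj -> Obj -> Type;
  idm : forall X, Hom X X;
  compm : forall X Y Z, Hom Y Z -> Hom X Y -> Hom X Z;
  compmA : forall X Y Z W (h : Hom Z W) (g : Hom Y Z) (f : Hom X Y),
    compm h (compm g f) = compm (compm h g) f;
  comp1m : forall X Y (f : Hom X Y), compm (idm Y) f = f;
  compm1 : forall X Y (f : Hom X Y), compm f (idm X) = f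
}.
Arguments Hom {c} X Y.
Arguments idm {c} X.
Arguments compm {c X Y Z} g f : rename.

Definition opposite (C : category) : category :=
  @Category (Obj C) (fun X Y => Hom Y X) (@idm C)
    (fun X Y Z g f => compm f g)
    (fun X Y Z W h g f => esym (compmA f g h))
    (fun X Y f => compm1 f) (fun X Y f => comp1m f).

Record functor (C D : category) := Functor {
  fobj :> C -> D;
  fmap : forall X Y : C, Hom X Y -> Hom (fobj X) (fobj Y);
  fmap1 : forall X : C, fmap (idm X) = idm (fobj X);
  fmapM : forall (X Y Z : C) (g : Hom Y Z) (f : Hom X Y),
    fmap (compm g f) = compm (fmap g) (fmap f)
}.

Definition functor_id (C : category) : functor C C :=
  @Functor C C id (fun _ _ f => f) (fun _ => erefl) (fun _ _ _ _ _ => erefl).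

Definition functor_comp (C D E : category) (G : functor D E)
    (F : functor C D) : functor C E :=
  @Functor C E (fun X => G (F X)) (fun _ _ f => fmap G (fmap F f))
    (fun X => etrans (congr1 (@fmap _ _ G _ _) (fmap1 F X)) (fmap1 G (F X)))
    (fun X Y Z g f => etrans (congr1 (@fmap _ _ G _ _) (fmapM F g f))
                             (fmapM G (fmap F g) (fmap F f))).

Definition isomorphism (C : category) (X Y : C) (f : Hom X Y) : Prop :=
  exists g : Hom Y X, compm g f = idm X /\ compm f g = idm Y.

Definition naturally_isomorphic (C D : category) (F G : functor C D) : Prop :=
  exists eta : forall X : C, Hom (F X) (G X),
    (forall X : C, isomorphism (eta X)) /\
    (forall (X Y : C) (f : Hom X Y),
       compm (eta Y) (fmap F f) = compm (fmap G f) (eta X)).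

Definition equivalent (C D : category) : Prop :=
  exists (F : functor C D) (G : functor D C),
    naturally_isomorphic (functor_comp G F) (functor_id C) /\
    naturally_isomorphic (functor_comp F G) (functor_id D).

Definition dually_equivalent (C D : category) : Prop :=
  equivalent (opposite C) D.

HB.mixin Record isRelativeStone d T of Order.TLattice d T := {
  imp : T -> T -> T;
  impP : forall a b c : T, (a `&` b <= c)%O <-> (a <= imp b c)%O;
  imp_prelinear : forall a b : T, (imp a b `|` imp b a)%O = \top%O
}.

#[short(type="relStoneType")]
HB.structure Definition RelativeStone d :=
  { T of Order.TLattice d T & isRelativeStone d T }.

HB.mixin Record isBRSAlgebra d T of RelativeStone d T := {
  bRSf : T;
  bRSfP : forall a : T, (a `|` imp a bRSf)%O = \top%O
}.

#[short(type="bRSAlgType")]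
HB.structure Definition BRSAlgebra d :=
  { T of RelativeStone d T & isBRSAlgebra d T }.

Record bRSA_hom d (A B : bRSAlgType d) (h : A -> B) : Prop := {
  bRSA_homI : {morph h : a b / (a `&` b)%O};
  bRSA_homU : {morph h : a b / (a `|` b)%O};
  bRSA_hom_imp : {morph h : a b / imp a b};
  bRSA_homT : h \top%O = \top%O;
  bRSA_homf : h bRSf = bRSf
}.

Lemma bRSA_hom_id d (A : bRSAlgType d) : bRSA_hom (@id A).
Proof. by []. Qed.

Lemma bRSA_hom_comp d (A B C : bRSAlgType d) (g : B -> C) (f : A -> B) :
  bRSA_hom g -> bRSA_hom f -> bRSA_hom (g \o f).
Proof.
case=> gI gU gi gT gf [fI fU fi fT ff].
by split=> [a b|a b|a b||] /=; rewrite ?(fI, fU, fi, fT, ff).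
Qed.

Lemma sval_inj_Prop T (P : T -> Prop) (u v : {x | P x}) :
  sval u = sval v -> u = v.
Proof.
by case: u v => [x Px] [y Py] /= xy; subst y; rewrite (Prop_irrelevance Px Py).
Qed.

Program Definition bRSA d : category := {|
  Obj := bRSAlgType d;
  Hom A B := {h : A -> B | bRSA_hom h};
  idm A := exist _ id (bRSA_hom_id A);
  compm A B C g f :=
    exist _ (sval g \o sval f) (bRSA_hom_comp (svalP g) (svalP f))
|}.
Next Obligation. by move=> *; exact: sval_inj_Prop. Qed.
Next Obligation. by move=> d A B f; exact: sval_inj_Prop. Qed.
Next Obligation. by move=> d A B f; exact: sval_inj_Prop. Qed.

Section ordered_spaces.
Context d (X : POrderedTopological.type d).
Implicit Types (x y z : X) (U : set X).

Definition up_set U := forall x y, U x -> (x <= y)%O -> U y.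

Definition down U : set X := [set x | exists2 y, U y & (x <= y)%O].

Definition priestley : Prop :=
  compact [set: X] /\
  forall x y, ~ (x <= y)%O ->
    exists U, [/\ clopen U, up_set U, U x & ~ U y].

Definition esakia : Prop :=
  priestley /\ forall U, clopen U -> clopen (down U).

Definition forest : Prop :=
  forall x y z, (x <= y)%O -> (x <= z)%O -> (y <= z)%O \/ (z <= y)%O.

Definition minimal x : Prop := forall y, (y <= x)%O -> y = x.

End ordered_spaces.

HB.structure Definition TPOrderedTopological d :=
  { T of POrderedTopological d T & Order.TPOrder d T }.

(* A minimal element may be the top only when the space is a single point, and
   [D = X = {top}] must be excluded: [~` D] interprets the constant [bRSf] in
   the dual algebra, whose elements are the nonempty clopen up-sets. *)
HB.mixin Record isBRSSpace d T of TPOrderedTopological d T := {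
  bRS_esakia : esakia T;
  bRS_forest : forest T;
  bRSD : set T;
  bRSD_clopen : clopen bRSD;
  bRSD_minimal : forall x : T, bRSD x -> minimal x;
  bRSD_top : ~ bRSD \top%O
}.

#[short(type="bRSSpaceType")]
HB.structure Definition BRSSpace d :=
  { T of TPOrderedTopological d T & isBRSSpace d T }.

Record bRSS_hom d (X Y : bRSSpaceType d) (phi : X -> Y) : Prop := {
  bRSS_hom_continuous : continuous phi;
  bRSS_hom_isotone : {homo phi : x y / (x <= y)%O};
  bRSS_hom_back : forall (x : X) (z : Y), (phi x <= z)%O ->
    exists2 y : X, (x <= y)%O & phi y = z;
  bRSS_homT : phi \top%O = \top%O;
  bRSS_homD : phi @` bRSD `<=` bRSD;
  bRSS_homDC : phi @` (~` bRSD) `<=` ~` bRSD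
}.

Lemma bRSS_hom_id d (X : bRSSpaceType d) : bRSS_hom (@id X).
Proof.
split=> //.
- by move=> x; exact: cvg_id.
- by move=> x z xz; exists z.
- by rewrite image_id.
- by rewrite image_id.
Qed.

Lemma bRSS_hom_comp d (X Y Z : bRSSpaceType d) (g : Y -> Z) (f : X -> Y) :
  bRSS_hom g -> bRSS_hom f -> bRSS_hom (g \o f).
Proof.
case=> gc gi gb gT gD gC [fc fi fb fT fD fC]; split.
- by move=> x; apply: continuous_comp; [exact: fc|exact: gc].
- by move=> x y xy; apply/gi/fi.
- move=> x z /gb[y /fb[x' xx' <-] <-]; by exists x'.
- by rewrite /= fT.
- by move=> _ [x Dx <-]; apply: gD; exists (f x) => //; apply: fD; exists x.
- by move=> _ [x Dx <-]; apply: gC; exists (f x) => //; apply: fC; exists x.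
Qed.

Program Definition bRSS d : category := {|
  Obj := bRSSpaceType d;
  Hom X Y := {phi : X -> Y | bRSS_hom phi};
  idm X := exist _ id (bRSS_hom_id X);
  compm X Y Z g f :=
    exist _ (sval g \o sval f) (bRSS_hom_comp (svalP g) (svalP f))
|}.
Next Obligation. by move=> *; exact: sval_inj_Prop. Qed.
Next Obligation. by move=> d X Y f; exact: sval_inj_Prop. Qed.
Next Obligation. by move=> d X Y f; exact: sval_inj_Prop. Qed.

(* Main.v *)
(** A bRS-algebra [A] is sent to its spectrum: the prime filters of [A] together
    with [A] itself, with base [phi a] and [phi a `\` phi b], where [phi a] is the
    set of points containing [a].  Separation and [down (phi a `\` phi b) =
    ~` phi (imp a b)] come from the prime filter theorem, compactness from the
    fact that an ultrafilter [F] on the spectrum converges to the point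
    [{a | F (phi a)}].  A bRS-space is sent to its clopen up-sets containing the
    top.  The units are [a |-> phi a] and [x |-> {U | U x}]; both are surjective
    by the finite intersection property applied to a directed family of closed
    sets, and a bijective morphism of either category is an isomorphism (on the
    space side because a continuous bijection from a compact space to a
    Hausdorff one is a homeomorphism). *)
From HB Require Import structures.
From mathcomp Require Import all_boot all_order.
From mathcomp Require Import boolp classical_sets filter topology.
Require Import Defs.

Set Implicit Arguments.
Unset Strict Implicit.
Unset Printing Implicit Defensive.

Import Order.TTheory.
Local Open Scope classical_set_scope.

(** * Filters, ideals and the prime filter theorem *)

Section prime_filter_theorem.
Context d (A : relStoneType d).
Implicit Types (a b c : A) (F I : set A).

Lemma le_imp a b c : (a <= imp b c)%O = (a `&` b <= c)%O.
Proof. by apply/idP/idP => /impP. Qed.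

Lemma leI_imp a b : (a `&` imp a b <= b)%O.
Proof. by rewrite meetC -le_imp. Qed.

(** Meeting with [a] is left adjoint to [imp a], so it preserves joins. *)
Lemma relStone_leIU a b c : (a `&` (b `|` c) <= (a `&` b) `|` (a `&` c))%O.
Proof.
by rewrite meetC -le_imp leUx !le_imp ![(_ `&` a)%O]meetC leUl leUr.
Qed.

Record lattice_filter F : Prop := {
  filter_top : F \top%O;
  filter_meet : forall a b, F a -> F b -> F (a `&` b)%O;
  filter_le : forall a b, F a -> (a <= b)%O -> F b
}.

(** May be empty: [A] need have no bottom, and in [spectrum_map_back] the ideal is empty when [z] is
    the improper filter. *)
Record lattice_ideal I : Prop := {
  ideal_join : forall a b, I a -> I b -> I (a `|` b)%O;
  ideal_le : forall a b, I b -> (a <= b)%O -> I a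
}.

(** The whole algebra counts as prime; it will be the top of the spectrum. *)
Record prime_filter F : Prop := {
  prime_filter_filter :> lattice_filter F;
  prime_filter_join : forall a b, F (a `|` b)%O -> F a \/ F b
}.

Lemma prime_filterT : prime_filter setT.
Proof. by split => // a b _; left. Qed.

Lemma prime_filter_mp F a b : prime_filter F -> F (imp a b) -> F a -> F b.
Proof.
by move=> pF Fab Fa; apply: (filter_le pF (filter_meet pF Fa Fab)) (leI_imp _ _).
Qed.

Lemma principal_filter a : lattice_filter [set b | (a <= b)%O].
Proof.
split => /= [|b c ab ac|b c ab bc]; [exact: lex1| |exact: le_trans bc].
by rewrite lexI ab.
Qed.

Lemma principal_ideal b : lattice_ideal [set a | (a <= b)%O].
Proof.
split => /= [a c ab cb|a c cb ac]; last exact: le_trans cb.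
by rewrite leUx ab.
Qed.

Lemma filter_join F G : lattice_filter F -> lattice_filter G ->
  lattice_filter [set c | exists a b, [/\ F a, G b & (a `&` b <= c)%O]].
Proof.
move=> fF fG; split => /=.
- by exists \top%O, \top%O; split; [exact: filter_top|exact: filter_top|exact: lex1].
- move=> c c' [a [b [Fa Gb abc]]] [a' [b' [Fa' Gb' abc']]].
  exists (a `&` a')%O, (b `&` b')%O; split; [exact: filter_meet..|].
  by rewrite meetACA leI2.
- by move=> c c' [a [b [Fa Gb abc]]] cc'; exists a, b; split => //; exact: le_trans cc'.
Qed.

(** A filter maximal among those that contain [F] and avoid [I] is prime, by distributivity. *)
Lemma prime_filter_exists F I : lattice_filter F -> lattice_ideal I ->
  (forall a, F a -> ~ I a) ->
  exists P, [/\ prime_filter P, F `<=` P & forall a, P a -> ~ I a].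
Proof.
move=> fF iI FI.
(* Zorn's lemma runs over the sets [X] added to [F], so that the empty chain yields [F] itself. *)
pose good X := lattice_filter (F `|` X) /\ forall a, (F `|` X) a -> ~ I a.
have [C Cgood Ctot|M [[fM MI] Mmax]] := @Zorn_bigcup A good.
  have common a b : (F `|` \bigcup_(X in C) X) a ->
      (F `|` \bigcup_(X in C) X) b ->
      (F a /\ F b) \/ exists2 X, C X & (F `|` X) a /\ (F `|` X) b.
    move=> [Fa|[X CX Xa]] [Fb|[Y CY Yb]].
    - by left.
    - by right; exists Y => //; split; [left|right].
    - by right; exists X => //; split; [right|left].
    - right; case: (Ctot _ _ CX CY) => sub; [exists Y|exists X] => //;
        by split; right => //; exact: sub.
  have sub X : C X -> F `|` X `<=` F `|` \bigcup_(X in C) X.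
    by move=> CX a [Fa|Xa]; [left|right; exists X].
  split; [split|].
  - by left; exact: filter_top.
  - move=> a b ha hb; have [[Fa Fb]|[X CX [Xa Xb]]] := common _ _ ha hb.
      by left; exact: filter_meet.
    by apply: (sub X CX); apply: filter_meet => //; case: (Cgood _ CX).
  - move=> a b ha ab; have [[Fa _]|[X CX [Xa _]]] := common _ _ ha ha.
      by left; exact: filter_le ab.
    by apply: (sub X CX); apply: filter_le ab => //; case: (Cgood _ CX).
  - move=> a ha; have [[Fa _]|[X CX [Xa _]]] := common _ _ ha ha.
      exact: FI.
    by case: (Cgood _ CX) => _; apply.
exists (F `|` M); split => //.
(* By maximality, the filter generated by [M], [F] and an outside element [a] meets [I]. *)
have extend a : ~ (F `|` M) a -> exists2 p, (F `|` M) p & I (p `&` a)%O.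
  move=> nMa; apply: contrapT => noI.
  pose N := [set c | exists p q, [/\ (F `|` M) p, (a <= q)%O & (p `&` q <= c)%O]].
  have fN : lattice_filter N by apply: filter_join => //; exact: principal_filter.
  have MN : F `|` M `<=` N.
    by move=> c Mc; exists c, a; split => //; exact: leIl.
  have Na : N a.
    by exists \top%O, a; split; [exact: filter_top| |rewrite meet1x].
  have FN : F `|` N = N by apply/setUidPr => c Fc; apply: MN; left.
  apply: (Mmax N).
    split; last by move=> /(_ a Na) Ma; apply: nMa; right.
    by move=> c Mc; apply: MN; right.
  split; rewrite FN // => c [p [q [Mp aq pqc]]] Ic.
  apply: noI; exists p => //; apply: (ideal_le iI Ic).
  by apply: le_trans pqc; rewrite leI2.
split=> // a b Mab; apply: contrapT => /not_orP[/extend[p Mp Ip] /extend[q Mq Iq]].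
(* This element is in the filter, yet distributivity puts it below a join of two elements of [I]. *)
apply: (MI ((p `&` q) `&` (a `|` b))%O).
  by apply: filter_meet => //; exact: filter_meet.
apply: (ideal_le iI) (relStone_leIU _ _ _); apply: ideal_join => //.
  by apply: (ideal_le iI Ip); rewrite leI2 // leIl.
by apply: (ideal_le iI Iq); rewrite leI2 // leIr.
Qed.

(** That [imp a b] is outside [F] means that the filter generated by [F] and [a] misses the ideal
    below [b]. *)
Lemma prime_filter_extend F a b : lattice_filter F -> ~ F (imp a b) ->
  exists P, [/\ prime_filter P, F `<=` P, P a & ~ P b].
Proof.
move=> fF nFab.
have [||c [p [q [Fp /= aq pqc]]] /= cb|P [pP FP PI]] := @prime_filter_exists
    [set c | exists p q, [/\ F p, (a <= q)%O & (p `&` q <= c)%O]]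
    [set c | (c <= b)%O].
- by apply: filter_join => //; exact: principal_filter.
- exact: principal_ideal.
- apply: nFab; apply: (filter_le fF Fp); rewrite le_imp.
  by apply: le_trans cb; apply: le_trans pqc; rewrite leI2.
- exists P; split => // [c Fc||/PI]; last by apply; exact: lexx.
    by apply: FP; exists c, a; split => //; exact: leIl.
  by apply: FP; exists \top%O, a; split; [exact: filter_top| |rewrite meet1x].
Qed.

Lemma prime_filter_separate a b : ~ (a <= b)%O ->
  exists P, [/\ prime_filter P, P a & ~ P b].
Proof.
move=> nab.
have [c /= ac cb|P [pP FP PI]] :=
    @prime_filter_exists _ _ (principal_filter a) (principal_ideal b).
  by apply: nab; exact: le_trans cb.
by exists P; split => // [|/PI]; [exact/FP/lexx|by apply; exact: lexx].
Qed.

End prime_filter_theorem.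

(** Directedness makes the sets a filter base; a cluster point in [K] lies in every closed [C i]. *)
Lemma compact_directed (T : topologicalType) (K : set T) I (D : set I)
    (C : I -> set T) :
  compact K -> D !=set0 -> (forall i, D i -> closed (C i)) ->
  (forall i j, D i -> D j -> exists2 k, D k & C k `<=` C i `&` C j) ->
  (forall i, D i -> K `&` C i !=set0) ->
  exists2 x, K x & forall i, D i -> C i x.
Proof.
move=> cK [i0 Di0] Ccl Cdir KC.
have FF : ProperFilter (filter_from D (fun i => K `&` C i)).
  apply: filter_from_proper => //; apply: filter_from_filter; first by exists i0.
  move=> i j Di Dj; have [k Dk kij] := Cdir _ _ Di Dj.
  by exists k => // x [Kx /kij[]].
have [|x [Kx]] := cK _ FF; first by exists i0 => // x [].
rewrite clusterE => clx; exists x => // i Di; apply: (Ccl i Di).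
have /clx : filter_from D (fun i => K `&` C i) (K `&` C i) by exists i.
by apply: closureS => y [].
Qed.

(** * Topology of Priestley spaces *)

Section priestley_spaces.
Context d (X : POrderedTopological.type d).

(** If open sets cannot separate [x] from [y], neither can clopen ones, and order separation then
    gives both inequalities. *)
Lemma priestley_hausdorff : priestley X -> hausdorff_space X.
Proof.
move=> [_ sep] x y xy.
have same U : clopen U -> U x -> U y.
  move=> [oU cU] Ux; apply: cU => V yV.
  by have := xy U V; apply => //; exact: open_nbhs_nbhs.
apply/eqP; rewrite eq_le; apply/andP; split.
  apply: contrapT => /sep[U [cU _ Ux nUy]]; exact/nUy/(same _ cU).
apply: contrapT => /sep[U [cU _ Uy nUx]].
exact: (same _ (clopenC set0 cU) nUx).
Qed.

(** For [x] in the closure of [down U], every clopen up-set around [x] meets [U]; by compactness one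
    [y] in [U] lies in all of them, and separation gives [x <= y]. *)
Lemma priestley_down_closed (U : set X) :
  priestley X -> closed U -> closed (down U).
Proof.
move=> [cX sep] cU x xU; have cptU := subclosed_compact cU cX (@subsetT _ _).
have [||||y Uy xy] := @compact_directed _ U (set X)
    [set V | [/\ clopen V, up_set V & V x]] id cptU.
- by exists setT; split => //; exact: clopenT.
- by move=> V [[_ cV] _ _].
- move=> V W [cV uV Vx] [cW uW Wx]; exists (V `&` W) => //; split => //.
    exact: clopenI.
  by move=> y z [Vy Wy] yz; split; [exact: uV yz|exact: uW yz].
- move=> V [[oV _] uV Vx].
  have [y [[z Uz yz] Vy]] := xU _ (open_nbhs_nbhs (conj oV Vx)).
  by exists z; split => //; exact: uV yz.
- exists y => //; apply: contrapT => /sep[V [cV uV Vx nVy]].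
  by apply: nVy; exact: (xy V).
Qed.

End priestley_spaces.

(* The display [e] of the order on the dual space is a phantom parameter. *)
Record spectrum (e : Order.disp_t) d (A : relStoneType d) := Spectrum {
  spectrum_set :> A -> Prop;
  spectrum_prime : prime_filter spectrum_set
}.

(** * The spectrum as an Esakia space and a forest *)

Section spectrum.
Context (e d : Order.disp_t) (A : relStoneType d).
Local Notation X := (spectrum e A).
Implicit Types (x y z : X) (a b : A) (U : set X).

Lemma spectrum_eqP x y : spectrum_set x = spectrum_set y -> x = y.
Proof.
case: x y => [x px] [y py] /= xy; subst y.
by rewrite (Prop_irrelevance px py).
Qed.

HB.instance Definition _ := gen_eqMixin X.
HB.instance Definition _ := gen_choiceMixin X.

Definition spectrum_le x y := `[< spectrum_set x `<=` spectrum_set y >].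

Fact spectrum_le_refl : reflexive spectrum_le.
Proof. by move=> x; exact/asboolP. Qed.

Fact spectrum_le_anti : antisymmetric spectrum_le.
Proof.
move=> x y /andP[/asboolP xy /asboolP yx].
by apply: spectrum_eqP; apply/seteqP.
Qed.

Fact spectrum_le_trans : transitive spectrum_le.
Proof.
move=> y x z /asboolP xy /asboolP yz; apply/asboolP; exact: subset_trans yz.
Qed.

HB.instance Definition _ := Order.Le_isPOrder.Build e X
  spectrum_le_refl spectrum_le_anti spectrum_le_trans.

Lemma spectrum_leP x y : reflect (spectrum_set x `<=` spectrum_set y) (x <= y)%O.
Proof. exact: asboolP. Qed.

Lemma spectrum_nle x y : ~ (x <= y)%O -> exists2 a, x a & ~ y a.
Proof.
move=> nxy; have /existsNP[a /not_implyP[xa nya]] : ~ spectrum_set x `<=` y.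
  by move=> xy; apply: nxy; exact/spectrum_leP.
by exists a.
Qed.

Fact spectrum_le_top x : (x <= Spectrum e (prime_filterT A))%O.
Proof. by apply/spectrum_leP. Qed.

HB.instance Definition _ := Order.hasTop.Build e X spectrum_le_top.

(* The sets [phi a] alone are also needed: every one of them contains the
   improper filter, hence no [phi a `\` phi b] does. *)
Definition spectrum_base (i : A * option A) : set X :=
  [set x : X | x i.1 /\ forall b, i.2 = Some b -> ~ x b].

Definition spectrum_open U :=
  forall x, U x -> exists2 i, spectrum_base i x & spectrum_base i `<=` U.

Lemma spectrum_baseI i j : exists k,
  spectrum_base i `&` spectrum_base j = spectrum_base k.
Proof.
(* Excluded elements combine by join because the points are prime filters. *)
exists ((i.1 `&` j.1)%O, if i.2 is Some b then
    if j.2 is Some c then Some (b `|` c)%O else i.2 else j.2).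
case: i j => [a ob] [a' ob']; apply/seteqP; split => x /=.
  move=> [[/= xa xb] [/= xa' xb']]; split => /=.
    by apply: filter_meet => //; exact: spectrum_prime.
  move=> c; case: ob ob' xb xb' => [b|] [b'|] /= xb xb' // [<-].
  - by move=> /(prime_filter_join (spectrum_prime x))[]; [exact: xb|exact: xb'].
  - exact: xb.
  - exact: xb'.
have px := spectrum_prime x; move=> [/= xaa xbb]; split; split => /=.
- exact: (filter_le px xaa) (leIl _ _).
- move=> b ob_b; rewrite ob_b in xbb; case: ob' xbb => [b'|] xbb xb.
    by apply: (xbb _ erefl); exact: (filter_le px xb) (leUl _ _).
  exact: (xbb _ erefl).
- exact: (filter_le px xaa) (leIr _ _).
- move=> b ob_b; rewrite ob_b in xbb; case: ob xbb => [b'|] xbb xb.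
    by apply: (xbb _ erefl); exact: (filter_le px xb) (leUr _ _).
  exact: (xbb _ erefl).
Qed.

Fact spectrum_openT : spectrum_open setT.
Proof.
move=> x _; exists (\top%O, None) => //; split => //.
exact: filter_top (spectrum_prime x).
Qed.

Fact spectrum_openI : setI_closed spectrum_open.
Proof.
move=> U V oU oV x [/oU[i ix iU] /oV[j jx jV]].
have [k ijk] := spectrum_baseI i j.
by exists k; rewrite -ijk //; exact: setISS.
Qed.

Fact spectrum_open_bigU I (U : I -> set X) :
  (forall i, spectrum_open (U i)) -> spectrum_open (\bigcup_i U i).
Proof.
move=> oU x [i _ /oU[j jx jU]]; exists j => //.
by apply: subset_trans jU _; exact: bigcup_sup.
Qed.

HB.instance Definition _ := isOpenTopological.Build X
  spectrum_openT spectrum_openI spectrum_open_bigU.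

Lemma spectrum_openE U : open U <-> spectrum_open U.
Proof. by []. Qed.

Definition phi a : set X := [set x : X | x a].

Lemma phi_clopen a : clopen (phi a).
Proof.
split.
  by apply/spectrum_openE => x xa; exists (a, None) => //= y [].
rewrite -[phi a]setCK; apply/open_closedC/spectrum_openE => x xa.
exists (\top%O, Some a); last by move=> y [_ /=]; exact.
split => /= [|b [<-] //]; exact: filter_top (spectrum_prime x).
Qed.

Lemma phi_up a : up_set (phi a).
Proof. by move=> x y xa /spectrum_leP; exact. Qed.

Lemma phi_top a : phi a \top%O.
Proof. by []. Qed.

Lemma phiI a b : phi (a `&` b)%O = phi a `&` phi b.
Proof.
apply/seteqP; split => x; have px := spectrum_prime x; last first.
  by move=> [xa xb]; exact: (filter_meet px xa xb).
by move=> xab; split; apply: (filter_le px xab); [exact: leIl|exact: leIr].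
Qed.

Lemma phiU a b : phi (a `|` b)%O = phi a `|` phi b.
Proof.
apply/seteqP; split => x; have px := spectrum_prime x.
  exact: (prime_filter_join px).
by move=> [xa|xb]; [apply: (filter_le px xa) (leUl _ _)|apply: (filter_le px xb) (leUr _ _)].
Qed.

Lemma phi_subset a b : (phi a `<=` phi b) <-> (a <= b)%O.
Proof.
split=> [ab|ab x xa]; last exact: (filter_le (spectrum_prime x) xa ab).
apply: contrapT => /prime_filter_separate[P [pP Pa nPb]].
exact/nPb/(ab (Spectrum e pP)).
Qed.

(** Left to right is modus ponens in the larger filter, right to left is [prime_filter_extend]. *)
Lemma down_phiD a b : down (phi a `\` phi b) = ~` phi (imp a b).
Proof.
apply/seteqP; split => [x [y [ya nyb] /spectrum_leP xy] xab|x nxab].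
  by apply: nyb; exact: prime_filter_mp (spectrum_prime y) (xy _ xab) ya.
have [P [pP xP Pa nPb]] := prime_filter_extend (spectrum_prime x) nxab.
by exists (Spectrum e pP) => //; exact/spectrum_leP.
Qed.

Lemma spectrum_compact : compact [set: X].
Proof.
rewrite compact_ultra => F uF _.
pose P := [set a : A | F (phi a)].
have pP : prime_filter P.
  split; [split|].
  - apply: filterS filterT => x _; exact: filter_top (spectrum_prime x).
  - by move=> a b Pa Pb; rewrite /P /= phiI; exact: filterI.
  - by move=> a b Pa /phi_subset ab; exact: filterS ab Pa.
  - move=> a b; rewrite /P /= phiU => Fab.
    (* The ultrafilter decides between [phi a] and its complement, which makes [P] prime. *)
    have [Fa|nFa] := in_ultra_setVsetC (phi a) uF; first by left.
    by right; apply: filterS (filterI Fab nFa) => x [[]].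
exists (Spectrum e pP); split => // V.
rewrite nbhsE => -[W [oW Wx] WV]; apply: filterS WV _.
have [[a ob] [/= Fa nFb] iW] := (spectrum_openE W).1 oW _ Wx; apply: filterS iW _.
case: ob nFb => [b|] nFb.
  have [//|Fb] := in_ultra_setVsetC (phi b) uF; first by move/(nFb _ erefl).
  by apply: filterS (filterI Fa Fb) => y [ya yb]; split => //= c [<-].
by apply: filterS Fa => y ya; split.
Qed.

Lemma spectrum_priestley : priestley X.
Proof.
split; first exact: spectrum_compact.
move=> x y /spectrum_nle[a xa nya].
by exists (phi a); split => //; [exact: phi_clopen|exact: phi_up].
Qed.

Lemma spectrum_esakia : esakia X.
Proof.
split; first exact: spectrum_priestley.
move=> U [oU cU]; split; last exact: priestley_down_closed spectrum_priestley _.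
rewrite openE => x [y Uy xy]; have [[a [b|]] iy iU] := (spectrum_openE U).1 oU _ Uy.
  have [ya /(_ _ erefl) nyb] := iy.
  have : nbhs x (down (phi a `\` phi b)).
    apply: open_nbhs_nbhs; split; last by exists y.
    by rewrite down_phiD; apply: closed_openC; case: (phi_clopen (imp a b)).
  apply: filterS => z [w [wa nwb] zw]; exists w => //; apply: iU.
  by split => //= c [<-].
(* With nothing excluded, the basic set contains the top, so [down U] is the whole space. *)
apply: filterS filterT => z _; exists (\top : X)%O; last exact: lex1.
exact: iU.
Qed.

(** If [a] separates [y] from [z] and [b] separates [z] from [y], prelinearity puts [imp a b] or
    [imp b a] in [x], and modus ponens gives a contradiction. *)
Lemma spectrum_forest : forest X.
Proof.
move=> x y z /spectrum_leP xy /spectrum_leP xz.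
apply: contrapT => /not_orP[/spectrum_nle[a ya nza] /spectrum_nle[b zb nyb]].
have px := spectrum_prime x.
have [xab|xba] : x (imp a b) \/ x (imp b a).
- by apply: (prime_filter_join px); rewrite imp_prelinear; exact: (filter_top px).
- by apply: nyb; apply: prime_filter_mp (xy _ xab) ya; exact: spectrum_prime.
- by apply: nza; apply: prime_filter_mp (xz _ xba) zb; exact: spectrum_prime.
Qed.

Lemma phi_surjective U : clopen U -> up_set U -> U \top%O ->
  exists a, phi a = U.
Proof.
move=> [oU cU] uU Utop.
(* The sets [phi a] with [a] in [x] intersect in the points above [x], all of which lie in [U]; by
   compactness one of these sets is inside [U]. *)
have sub x : U x -> exists2 a, x a & phi a `<=` U.
  move=> Ux; apply: contrapT => nsub; have px := spectrum_prime x.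
  have [|||a b|a xa|y nUy xy] := @compact_directed _ (~` U) A (spectrum_set x) phi.
  - apply: subclosed_compact spectrum_compact (@subsetT _ _).
    exact: open_closedC.
  - by exists \top%O; exact: (filter_top px).
  - by move=> a _; case: (phi_clopen a).
  - move=> xa xb; exists (a `&` b)%O; first exact: (filter_meet px).
    by rewrite phiI.
  - apply: contrapT => disj; apply: nsub; exists a => // y ya.
    by apply: contrapT => nUy; apply: disj; exists y.
  - by apply: nUy; apply: uU Ux _; exact/spectrum_leP.
apply: contrapT => noa.
(* The sets [phi a] inside [U] now cover the compact [U] and are directed under joins, so one of
   them is [U]. *)
have [||a|a b|a /= aU|y Uy noy] := @compact_directed _ U A
    [set a | phi a `<=` U] (fun a => ~` phi a).
- exact: subclosed_compact spectrum_compact (@subsetT _ _).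
- by have [a _ aU] := sub _ Utop; exists a.
- by move=> _; apply: open_closedC; case: (phi_clopen a).
- move=> /= aU bU; exists (a `|` b)%O; rewrite /= phiU ?setCU //.
  by rewrite subUset.
- apply: contrapT => disj; apply: noa; exists a; apply/seteqP; split => // x Ux.
  by apply: contrapT => nax; apply: disj; exists x.
- by have [a ya aU] := sub _ Uy; exact: (noy a).
Qed.

End spectrum.

(** * The designated set of the spectrum *)

Section spectrum_bRS.
Context (e d : Order.disp_t) (A : bRSAlgType d).
Local Notation X := (spectrum e A).

Definition spectrum_D : set X := ~` phi bRSf.

Fact spectrum_D_clopen : clopen spectrum_D.
Proof. by apply: (clopenC set0); exact: phi_clopen. Qed.

(** For [y] below [x] and [a] in [x], [y] contains [a] or [imp a bRSf]; the latter would put [bRSf]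
    in [x]. *)
Fact spectrum_D_minimal (x : X) : spectrum_D x -> minimal x.
Proof.
move=> nxf y /spectrum_leP yx; apply: spectrum_eqP; apply/seteqP; split => // a xa.
have py := spectrum_prime y.
have [//|/yx xaf] : y a \/ y (imp a bRSf).
  by apply: (prime_filter_join py); rewrite bRSfP; exact: (filter_top py).
by case: nxf; exact: prime_filter_mp (spectrum_prime x) xaf xa.
Qed.

Fact spectrum_D_top : ~ spectrum_D \top%O.
Proof. by apply; exact: phi_top. Qed.

HB.instance Definition _ := isBRSSpace.Build e X
  (@spectrum_esakia e d A) (@spectrum_forest e d A)
  spectrum_D_clopen spectrum_D_minimal spectrum_D_top.

End spectrum_bRS.

(* An up-set is nonempty exactly when it contains the top. *)
Record clopen_upset (d : Order.disp_t) e (X : bRSSpaceType e) := ClopenUpset {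
  upset_set :> X -> Prop;
  upset_clopen : clopen upset_set;
  upset_up : up_set upset_set;
  upset_top : upset_set \top%O
}.

(** * The bRS-algebra of clopen up-sets *)

Section clopen_upset.
Context (d e : Order.disp_t) (X : bRSSpaceType e).
Local Notation L := (clopen_upset d X).
Implicit Types (U V W : L) (x y : X).

Lemma upset_eqP U V : upset_set U = upset_set V -> U = V.
Proof.
case: U V => [U cU uU tU] [V cV uV tV] /= UV; subst V.
by congr ClopenUpset; exact: Prop_irrelevance.
Qed.

HB.instance Definition _ := gen_eqMixin L.
HB.instance Definition _ := gen_choiceMixin L.

Definition upset_le U V := `[< upset_set U `<=` upset_set V >].

Fact upset_le_refl : reflexive upset_le.
Proof. by move=> U; exact/asboolP. Qed.

Fact upset_le_anti : antisymmetric upset_le.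
Proof.
move=> U V /andP[/asboolP UV /asboolP VU].
by apply: upset_eqP; apply/seteqP.
Qed.

Fact upset_le_trans : transitive upset_le.
Proof.
move=> V U W /asboolP UV /asboolP VW; apply/asboolP; exact: subset_trans VW.
Qed.

HB.instance Definition _ := Order.Le_isPOrder.Build d L
  upset_le_refl upset_le_anti upset_le_trans.

Lemma upset_leP U V : reflect (upset_set U `<=` upset_set V) (U <= V)%O.
Proof. exact: asboolP. Qed.

Definition upset_meet U V : L.
Proof.
refine (@ClopenUpset d e X (upset_set U `&` upset_set V) _ _ _).
- by apply: clopenI; exact: upset_clopen.
- by move=> x y [Ux Vx] xy; split; apply: (upset_up _ xy).
- by split; exact: upset_top.
Defined.

Definition upset_join U V : L.
Proof.
refine (@ClopenUpset d e X (upset_set U `|` upset_set V) _ _ _).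
- by apply: clopenU; exact: upset_clopen.
- by move=> x y [Ux|Vx] xy; [left|right]; apply: (upset_up _ xy).
- by left; exact: upset_top.
Defined.

(** The Heyting implication of up-sets, in the form whose clopenness is the Esakia condition;
    [upset_impE] gives the pointwise form. *)
Definition upset_imp U V : L.
Proof.
refine (@ClopenUpset d e X (~` down (upset_set U `\` upset_set V)) _ _ _).
- apply: (clopenC set0); apply: (bRS_esakia (s := X)).2.
  by rewrite setDE; apply: clopenI; [|apply: (clopenC set0)]; exact: upset_clopen.
- by move=> x y nx xy [z UVz yz]; apply: nx; exists z => //; exact: le_trans yz.
(* Only the top lies above the top, and it belongs to [V]. *)
- by move=> [z [_ nVz]]; rewrite le1x => /eqP z1; apply: nVz; rewrite z1; exact: upset_top.
Defined.

Definition upset_full : L :=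
  @ClopenUpset d e X setT clopenT (fun _ _ _ _ => I) I.

Definition upset_f : L.
Proof.
refine (@ClopenUpset d e X (~` bRSD) _ _ _).
- by apply: (clopenC set0); exact: bRSD_clopen.
- by move=> x y nDx xy Dy; apply: nDx; rewrite (bRSD_minimal _ Dy _ xy).
- exact: bRSD_top.
Defined.

Fact upset_meetP U V W : (U <= upset_meet V W)%O = (U <= V)%O && (U <= W)%O.
Proof.
apply/upset_leP/andP => [UVW|[/upset_leP UV /upset_leP UW] x Ux].
  by split; apply/upset_leP => x /UVW[].
by split; [exact: UV|exact: UW].
Qed.

Fact upset_joinP U V W : (upset_join U V <= W)%O = (U <= W)%O && (V <= W)%O.
Proof.
apply/upset_leP/andP => [UVW|[/upset_leP UW /upset_leP VW] x [/UW|/VW]//].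
by split; apply/upset_leP => x Ux; apply: UVW; [left|right].
Qed.

Fact upset_le_full U : (U <= upset_full)%O.
Proof. exact/upset_leP. Qed.

HB.instance Definition _ := Order.POrder_MeetJoin_isLattice.Build d L
  upset_meetP upset_joinP.
HB.instance Definition _ := Order.hasTop.Build d L upset_le_full.

Lemma upset_impE U V x :
  upset_imp U V x <-> forall y, (x <= y)%O -> U y -> V y.
Proof.
split=> [nx y xy Uy|UV [y [Uy nVy] xy]]; last exact/nVy/UV.
by apply: contrapT => nVy; apply: nx; exists y.
Qed.

Fact upset_impP U V W : (U `&` V <= W)%O <-> (U <= upset_imp V W)%O.
Proof.
split=> /upset_leP UVW; apply/upset_leP.
  move=> x Ux; apply/upset_impE => y xy Vy.
  by apply: UVW; split => //; exact: (upset_up Ux xy).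
by move=> x [/UVW/upset_impE + Vx]; apply.
Qed.

(** Points above [x] refuting the two implications are comparable in a forest, so up-closure of [U]
    or [V] is violated. *)
Fact upset_imp_prelinear U V :
  (upset_imp U V `|` upset_imp V U)%O = \top%O :> L.
Proof.
apply: upset_eqP; apply/seteqP; split => // x _; apply: contrapT.
move=> /not_orP[/contrapT[y [Uy nVy] xy] /contrapT[z [Vz nUz] xz]].
have [yz|zy] := bRS_forest _ _ _ xy xz.
  by apply: nUz; exact: upset_up yz.
by apply: nVy; exact: upset_up zy.
Qed.

HB.instance Definition _ := isRelativeStone.Build d L
  upset_impP upset_imp_prelinear.

(** A point of [U] in [bRSD] above [x] equals [x] by minimality. *)
Fact upset_fP U : (U `|` imp U upset_f)%O = \top%O.
Proof.
apply: upset_eqP; apply/seteqP; split => // x _; apply: contrapT.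
move=> /not_orP[nUx /contrapT[y [Uy /contrapT Dy] xy]].
by apply: nUx; rewrite (bRSD_minimal _ Dy _ xy).
Qed.

HB.instance Definition _ := isBRSAlgebra.Build d L upset_fP.

End clopen_upset.

(** * Duals of homomorphisms: preimages of prime filters *)

Section spectrum_map.
Context (e d : Order.disp_t) (A B : bRSAlgType d) (h : A -> B).
Hypothesis hh : bRSA_hom h.

Let h_le a b : (a <= b)%O -> (h a <= h b)%O.
Proof. by rewrite !leEmeet => /eqP ab; rewrite -(bRSA_homI hh) ab. Qed.

Fact preimage_prime (x : spectrum e B) : prime_filter (h @^-1` spectrum_set x).
Proof.
have px := spectrum_prime x; split; [split|] => /=.
- by rewrite (bRSA_homT hh); exact: (filter_top px).
- by move=> a b xa xb; rewrite (bRSA_homI hh); exact: (filter_meet px).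
- by move=> a b xa ab; apply: (filter_le px xa); exact: h_le.
- by move=> a b; rewrite (bRSA_homU hh); exact: (prime_filter_join px).
Qed.

Definition spectrum_map (x : spectrum e B) : spectrum e A :=
  Spectrum e (preimage_prime x).

Fact spectrum_map_continuous : continuous spectrum_map.
Proof.
apply/continuousP => U /spectrum_openE oU; apply/spectrum_openE => x /oU.
move=> [[a ob] [/= xa xb] iU]; exists (h a, omap h ob).
  by split => //= c; case: ob xb {iU} => //= b xb [<-]; exact: xb.
move=> y [/= ya yb]; apply: iU; split => //= b obE.
by apply: yb; rewrite obE.
Qed.

(* The fibre point is a prime filter containing [x] and [h @` z] but avoiding
   the ideal generated by [h @` (~` z)]. *)
Fact spectrum_map_back (x : spectrum e B) (z : spectrum e A) :
  (spectrum_map x <= z)%O -> exists2 y, (x <= y)%O & spectrum_map y = z.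
Proof.
move=> /spectrum_leP xz; have px := spectrum_prime x; have pz := spectrum_prime z.
have fhz : lattice_filter [set c | exists2 a, z a & (h a <= c)%O].
  split.
  - by exists \top%O; [exact: (filter_top pz)|exact: lex1].
  - move=> c c' [a za ac] [a' za' ac']; exists (a `&` a')%O.
      exact: (filter_meet pz).
    by rewrite (bRSA_homI hh) leI2.
  - by move=> c c' [a za ac] cc'; exists a => //; exact: le_trans cc'.
have ihz : lattice_ideal [set c | exists2 b, ~ z b & (c <= h b)%O].
  split.
  - move=> c c' [b nzb cb] [b' nzb' cb']; exists (b `|` b')%O.
      by move=> /(prime_filter_join pz)[].
    by rewrite (bRSA_homU hh) leU2.
  - by move=> c c' [b nzb cb] cc'; exists b => //; exact: le_trans cb.
have [|P [pP FP PI]] := prime_filter_exists (filter_join px fhz) ihz.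
  (* Here [p] meet [h a] is below [h b], so [p] is below [h (imp a b)]; hence [imp a b] is in the
     preimage of [x], so in [z], and [b] follows by modus ponens. *)
  move=> c [p [q [xp [a za aq] pqc]]] [b nzb cb]; apply: nzb.
  apply: (prime_filter_mp pz) za; apply: xz => /=.
  rewrite (bRSA_hom_imp hh); apply: (filter_le px xp); rewrite le_imp.
  by apply: le_trans cb; apply: le_trans pqc; rewrite leI2.
exists (Spectrum e pP).
  apply/spectrum_leP => c xc; apply: FP; exists c, \top%O.
  by split => //; [exact: filter_top|exact: leIl].
apply: spectrum_eqP; apply/seteqP; split => a /= => [Pha|za].
  by apply: contrapT => nza; apply: (PI _ Pha); exists a.
apply: FP; exists \top%O, (h a); split; [exact: (filter_top px)| |exact: leIr].
by exists a.
Qed.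

Lemma spectrum_map_hom : bRSS_hom spectrum_map.
Proof.
split.
- exact: spectrum_map_continuous.
- by move=> x y /spectrum_leP xy; apply/spectrum_leP => a; exact: xy.
- exact: spectrum_map_back.
- by apply: spectrum_eqP.
- by move=> _ [x Dx <-]; rewrite /bRSD /= /spectrum_D /phi /= (bRSA_homf hh).
- by move=> _ [x Dx <-]; rewrite /bRSD /= /spectrum_D /phi /= (bRSA_homf hh).
Qed.

End spectrum_map.

(** * Duals of space morphisms: preimages of clopen up-sets *)

Section upset_map.
Context (d e : Order.disp_t) (X Y : bRSSpaceType e) (g : X -> Y).
Hypothesis gg : bRSS_hom g.

Definition upset_map (U : clopen_upset d Y) : clopen_upset d X.
Proof.
refine (@ClopenUpset d e X (g @^-1` upset_set U) _ _ _).
- by apply: preimage_clopen; [exact: upset_clopen|exact: bRSS_hom_continuous gg].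
- by move=> x y Ux xy; apply: (upset_up Ux); exact: bRSS_hom_isotone.
- by rewrite /preimage /= (bRSS_homT gg); exact: upset_top.
Defined.

(** Preservation of implication rests on isotony and the back condition, that of [bRSf] on the two
    conditions on [bRSD]. *)
Lemma upset_map_hom : bRSA_hom upset_map.
Proof.
split.
- by move=> U V; exact: upset_eqP.
- by move=> U V; exact: upset_eqP.
- move=> U V; apply: upset_eqP; apply/seteqP; split => x; last first.
    move=> /upset_impE UV; apply/upset_impE => y gxy.
    have [x' xx' <-] := bRSS_hom_back gg gxy; exact: UV.
  move=> /upset_impE UV; apply/upset_impE => y xy; apply: UV.
  exact: bRSS_hom_isotone.
- exact: upset_eqP.
- apply: upset_eqP; apply/seteqP; split => x nDx Dx.
    by apply: nDx; apply: (bRSS_homD gg); exists x.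
  by apply: (bRSS_homDC gg _ Dx); exists x.
Qed.

End upset_map.

(** * The two functors *)

Program Definition spectrum_functor (d e : Order.disp_t) :
    functor (opposite (bRSA d)) (bRSS e) := {|
  fobj := fun A => spectrum e (A : bRSAlgType d) : bRSSpaceType e;
  fmap := fun (A B : opposite (bRSA d)) h =>
    exist _ (spectrum_map (svalP h)) (spectrum_map_hom e (svalP h))
|}.
Next Obligation.
by move=> d e A; apply: sval_inj_Prop; apply/funext => x; exact: spectrum_eqP.
Qed.
Next Obligation.
by move=> d e A B C g f; apply: sval_inj_Prop; apply/funext => x; exact: spectrum_eqP.
Qed.

Program Definition upset_functor (d e : Order.disp_t) :
    functor (bRSS e) (opposite (bRSA d)) := {|
  fobj := fun X => clopen_upset d (X : bRSSpaceType e) : bRSAlgType d;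
  fmap := fun (X Y : bRSS e) g =>
    exist _ (upset_map (svalP g)) (upset_map_hom d (svalP g))
|}.
Next Obligation.
by move=> d e X; apply: sval_inj_Prop; apply/funext => U; exact: upset_eqP.
Qed.
Next Obligation.
by move=> d e X Y Z g f; apply: sval_inj_Prop; apply/funext => U; exact: upset_eqP.
Qed.

(** * The unit on algebras *)

Section algebra_unit.
Context (d e : Order.disp_t) (A : bRSAlgType d).

Definition phi_upset (a : A) : clopen_upset d (spectrum e A) :=
  @ClopenUpset d e (spectrum e A) (phi a) (phi_clopen e a) (@phi_up e d A a)
    (phi_top e a).

Lemma phi_upset_hom : bRSA_hom phi_upset.
Proof.
split.
- by move=> a b; apply: upset_eqP; exact: phiI.
- by move=> a b; apply: upset_eqP; exact: phiU.
- by move=> a b; apply: upset_eqP => /=; rewrite down_phiD setCK.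
- apply: upset_eqP; apply/seteqP; split => // x _.
  exact: (filter_top (spectrum_prime x)).
- by apply: upset_eqP => /=; rewrite /bRSD /= /spectrum_D setCK.
Qed.

Lemma phi_upset_bij : bijective phi_upset.
Proof.
have phi_inj a b : phi_upset a = phi_upset b -> a = b.
  move=> ab; have {}ab : phi a = phi b :> set (spectrum e A).
    exact: (congr1 (@upset_set _ _ _) ab).
  by apply/eqP; rewrite eq_le; apply/andP; split; apply/(phi_subset e); rewrite ab.
have /choice[f fK] (U : clopen_upset d (spectrum e A)) :
    exists a, phi_upset a = U.
  have [a aU] := phi_surjective (upset_clopen U) (@upset_up _ _ _ U) (upset_top U).
  by exists a; exact: upset_eqP.
by exists f => // a; apply: phi_inj; rewrite fK.
Qed.

End algebra_unit.

Lemma bRSA_bij_iso d (A B : bRSAlgType d) (h : A -> B) (hh : bRSA_hom h) :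
  bijective h -> @isomorphism (bRSA d) A B (exist _ h hh).
Proof.
move=> [k hK kK]; have kh : bRSA_hom k.
  have [hI hU hi hT hf] := hh.
  by split => [a b|a b|a b||]; apply: (can_inj hK); rewrite ?(hI, hU, hi, hT, hf) !kK.
exists (exist _ k kh).
by split; apply: sval_inj_Prop; apply/funext => x /=; rewrite ?hK ?kK.
Qed.

(** * The unit on spaces *)

Section space_unit.
Context (d e : Order.disp_t) (X : bRSSpaceType e).
Local Notation Y := (spectrum e (clopen_upset d X)).
Implicit Types (x y : X).

Fact upsets_prime x : prime_filter [set U : clopen_upset d X | U x].
Proof.
split; [split|] => //=.
  by move=> U V Ux /upset_leP; exact.
Qed.

Definition upsets_at x : Y := Spectrum e (upsets_prime x).

Lemma upsets_at_le x y : (upsets_at x <= upsets_at y)%O = (x <= y)%O.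
Proof.
apply/spectrum_leP/idP => [xy|xy U Ux]; last exact: (upset_up Ux xy).
apply: contrapT => /(bRS_esakia (s := X)).1.2[U [cU uU Ux nUy]].
(* A separating up-set is inhabited, so it contains the top and is an element of the dual
   algebra. *)
have Ut : U \top%O by apply: uU Ux _; exact: lex1.
exact/nUy/(xy (ClopenUpset d cU uU Ut)).
Qed.

(** The improper filter comes from the top. Otherwise the closed sets [U] minus [V], with [U] in [z]
    and [V] outside, form a nonempty directed family, and any common point is a preimage of [z]. *)
Lemma upsets_at_surj (z : Y) : exists x, upsets_at x = z.
Proof.
have pz := spectrum_prime z.
have [[V0 nzV0]|noV] := pselect (exists V, ~ z V); last first.
  exists \top%O; apply: spectrum_eqP; apply/seteqP; split => U _ /=.
    by apply: contrapT => nzU; apply: noV; exists U.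
  exact: upset_top.
have [||||x _ zx] := @compact_directed X setT
    (clopen_upset d X * clopen_upset d X) [set UV | z UV.1 /\ ~ z UV.2]
    (fun UV => upset_set UV.1 `\` upset_set UV.2) (bRS_esakia (s := X)).1.1.
- by exists (\top%O, V0); split => //; exact: (filter_top pz).
- move=> [U V] _ /=; rewrite setDE; apply: closedI.
    by case: (upset_clopen U).
  by apply: open_closedC; case: (upset_clopen V).
- move=> [U V] [U' V'] [/= zU nzV] [/= zU' nzV'].
  exists ((U `&` U')%O, (V `|` V')%O); first split => /=.
  + exact: (filter_meet pz).
  + by move=> /(prime_filter_join pz)[].
  + by move=> x [[Ux U'x] /not_orP[nVx nV'x]].
- move=> [U V] [/= zU nzV]; apply: contrapT => UV; apply: nzV.
  apply: (filter_le pz zU); apply/upset_leP => x Ux; apply: contrapT => nVx.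
  by apply: UV; exists x.
exists x; apply: spectrum_eqP; apply/seteqP; split => U /=.
  move=> Ux; apply: contrapT => nzU.
  by have [] := zx (\top%O, U) (conj (filter_top pz) nzU).
by move=> zU; have [] := zx (U, V0) (conj zU nzV0).
Qed.

Lemma upsets_at_continuous : continuous upsets_at.
Proof.
apply/continuousP => U oU; rewrite openE => x Ux.
have [[V oW] [/= Vx nWx] iU] := (spectrum_openE U).1 oU _ Ux.
apply: (@filterS _ _ _ (upset_set V `&` [set y | forall W, oW = Some W -> ~ W y])).
  by move=> y [Vy nWy]; apply: iU.
apply: filterI.
  by apply: open_nbhs_nbhs; split => //; case: (upset_clopen V).
case: oW nWx {iU} => [W|] nWx; last by apply: filterS filterT.
apply: (@filterS _ _ _ (~` upset_set W)); first by move=> y nWy _ [<-].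
apply: open_nbhs_nbhs; split; last exact: nWx.
by apply: closed_openC; case: (upset_clopen W).
Qed.

(** The left side unfolds to the double negation of the right. *)
Lemma upsets_at_D x : bRSD (upsets_at x) <-> bRSD x.
Proof. by split=> [/contrapT|Dx]; last exact. Qed.

Lemma upsets_at_hom : bRSS_hom upsets_at.
Proof.
split.
- exact: upsets_at_continuous.
- by move=> x y; rewrite upsets_at_le.
- move=> x z; have [y <-] := upsets_at_surj z; rewrite upsets_at_le => xy.
  by exists y.
- by apply/eqP; rewrite eq_le lex1 /=; apply/spectrum_leP => U _; exact: upset_top.
- by move=> _ [x Dx <-]; exact/upsets_at_D.
- by move=> _ [x nDx <-] /upsets_at_D.
Qed.

Lemma upsets_at_bij : bijective upsets_at.
Proof.
have [f fK] := choice upsets_at_surj; exists f => // x.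
by apply/eqP; rewrite eq_le -!upsets_at_le fK lexx.
Qed.

End space_unit.

(** Conditions trade places under inversion: the back condition of [g] gives isotony of [k] and
    conversely, and the conditions on [bRSD] and on its complement swap. *)
Lemma bRSS_bij_iso e (X Y : bRSSpaceType e) (g : X -> Y) (gg : bRSS_hom g) :
  bijective g -> @isomorphism (bRSS e) X Y (exist _ g gg).
Proof.
move=> [k gK kK]; have kh : bRSS_hom k.
  have [gc gi gb gT gD gC] := gg; split.
  - apply/continuous_closedP => C cC.
    have -> : k @^-1` C = g @` C.
      by apply/seteqP; split => [y Cy|_ [x Cx <-]] /=; [exists (k y)|rewrite gK].
    apply: compact_closed; first exact: priestley_hausdorff (bRS_esakia (s := Y)).1.
    apply: continuous_compact; first exact: continuous_subspaceT.
    exact: subclosed_compact cC (bRS_esakia (s := X)).1.1 (@subsetT _ _).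
  - move=> x y xy; have [|z kxz gz] := gb (k x) y; first by rewrite kK.
    by rewrite -gz gK.
  - by move=> y x kyx; exists (g x); rewrite ?gK // -[y]kK; exact: gi.
  - by rewrite -gT gK.
  - move=> _ [y Dy <-]; apply: contrapT => nD.
    by apply: (gC (g (k y))); [exists (k y)|rewrite kK].
  - move=> _ [y nDy <-] D; apply: nDy; rewrite -[y]kK.
    by apply: gD; exists (k y).
exists (exist _ k kh).
by split; apply: sval_inj_Prop; apply/funext => x /=; rewrite ?gK ?kK.
Qed.

(** * Assembling the equivalence *)

Lemma naturally_isomorphic_sym (C D : category) (F G : functor C D) :
  naturally_isomorphic F G -> naturally_isomorphic G F.
Proof.
move=> [eta [iso nat]].
exists (fun X => sval (cid (iso X))); split=> [X|X Y f].
  by have [gf fg] := svalP (cid (iso X)); exists (eta X).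
have [_] := svalP (cid (iso X)); have [+ _] := svalP (cid (iso Y)).
move: (sval _) (sval _) => k g kf fg.
rewrite -[fmap G f]compm1 -fg [compm (fmap G f) _]compmA -nat -compmA.
by rewrite compmA kf comp1m.
Qed.

Theorem mainTheorem8 (d e : Order.disp_t) :
  dually_equivalent (bRSA d) (bRSS e).
Proof.
exists (spectrum_functor d e), (upset_functor d e); split.
  (* In the opposite category this homomorphism out of [A] is an arrow into [A], as required. *)
  exists (fun A => exist _ _ (phi_upset_hom e A)); split => [A|A B h].
    have [g [gf fg]] := bRSA_bij_iso (phi_upset_hom e A) (phi_upset_bij e A).
    by exists g.
  by apply: sval_inj_Prop; apply/funext => a; apply: upset_eqP.
(* The unit on spaces starts at [X], against the required direction. *)
apply: naturally_isomorphic_sym.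
exists (fun X => exist _ _ (upsets_at_hom d X)); split => [X|X Y g].
  exact: bRSS_bij_iso (upsets_at_bij d X).
by apply: sval_inj_Prop; apply/funext => x; apply: spectrum_eqP.
Qed.
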